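(* Consider problem (P) with $d_i=p$, $A_i=I_p$ and $\mathcal{X}_i=\mathbb{R}^{p}$ for all $i$, under Assumption 1, let $\mathcal{G}$ be a directed, strongly connected and weight-balanced graph, and suppose each $f_i$ is $\mu_i$-strongly convex and $l_i$-smooth. Let $\mu=\min_i\mu_i$, $l=\max_i l_i$, $\varphi>0$, and let $\alpha,\beta$ satisfy $$\alpha\ge\max\Big\{\tfrac12,\;\frac{(\varphi^2+3\varphi+3)+l^2+\frac32-\mu}{(\varphi+1)\mu}\Big\},\qquad \beta\ge\frac{2(\varphi+1)^2\alpha^2+1}{2\varphi\alpha\,\eta_2(\hat L)}.$$ Then for any initial point $(\mathbf{x}(0),\boldsymbol\lambda(0),\mathbf{z}(0))\in\mathbb{R}^{np}\times\mathbb{R}^{np}\times\mathbb{R}^{np}$ with $\sum_{i=1}^n z_i(0)=0$, the trajectory of IDEA converges exponentially to a point $(\mathbf{x}^*,\boldsymbol\lambda^*,\mathbf{z}^* )$, where $\mathbf{x}^*$ is the unique optimal solution of (P).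
   Context: Problem (P): for $i=1,\dots,n$ let $f_i:\mathbb{R}^{d_i}\to\mathbb{R}$, $\mathcal{X}_i\subseteq\mathbb{R}^{d_i}$, $A_i\in\mathbb{R}^{p\times d_i}$, $b\in\mathbb{R}^p$; $d=\sum_i d_i$, $\mathbf{x}=[x_1^\top,\dots,x_n^\top]^\top$, $f(\mathbf{x})=\sum_i f_i(x_i)$, $A=[A_1,\dots,A_n]$, $\mathcal{X}=\prod_i\mathcal{X}_i$; (P) is $\min f(\mathbf{x})$ s.t. $A\mathbf{x}=b$, $\mathbf{x}\in\mathcal{X}$, assumed to have at least one optimal solution. Assumption 1: each $\mathcal{X}_i$ is closed and convex, $f_i$ is convex on $\mathcal{X}_i$ and differentiable on an open set containing $\mathcal{X}_i$ with $\nabla f_i$ locally Lipschitz there, and Slater's condition holds. $l_i$-smooth means $\nabla f_i$ is $l_i$-Lipschitz. Graph: weighted digraph with adjacency $[a_{ij}]$ ($a_{ij}>0$ if agent $i$ receives from agent $j$, else $0$); Laplacian $L=\mathrm{diag}(\sum_j a_{ij})_i-[a_{ij}]$; weight-balanced: $\sum_j a_{ji}=\sum_j a_{ij}$ for all $i$; strongly connected: directed path between any pair. $\hat L=(L+L^\top)/2$, $\eta_2(\hat L)$ its second smallest eigenvalue. IDEA: choose $b_1,\dots,b_n$ with $\sum_i b_i=b$; $\mathbf{A}=\mathrm{diag}(A_1,\dots,A_n)$, $\mathbf{b}=[b_1^\top,\dots,b_n^\top]^\top$, $\mathbf{L}=L\otimes I_p$, $\nabla f(\mathbf{x})=[\nabla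 f_1(x_1)^\top,\dots,\nabla f_n(x_n)^\top]^\top$. IDEA is $\dot{\mathbf{x}}=-\alpha(\nabla f(\mathbf{x})+\mathbf{A}^\top\boldsymbol\lambda)-\mathbf{A}^\top(\mathbf{A}\mathbf{x}-\mathbf{b}-\mathbf{z})$, $\dot{\boldsymbol\lambda}=\mathbf{A}\mathbf{x}-\mathbf{b}-\mathbf{z}-\beta\mathbf{L}\boldsymbol\lambda$, $\dot{\mathbf{z}}=\alpha\beta\mathbf{L}\boldsymbol\lambda$, with $\mathbf{z}=[z_1^\top,\dots,z_n^\top]^\top$. Exponential convergence means the distance to the limit is bounded by $Ce^{-ct}$ for some $C,c>0$. *)

(* Defs.v *)
From HB Require Import structures.
From mathcomp Require Import all_boot all_order all_algebra.
From mathcomp Require Import all_classical all_reals all_analysis.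
Set Implicit Arguments. Unset Strict Implicit. Unset Printing Implicit Defensive.
Import Order.TTheory GRing.Theory Num.Theory.
Import numFieldNormedType.Exports.
Local Open Scope ring_scope.

Section Defs.
Variable R : realType.

Definition dotv (p : nat) (u v : 'rV[R]_p) : R := \sum_(k < p) u 0 k * v 0 k.
Definition sqn (p : nat) (u : 'rV[R]_p) : R := dotv u u.

Definition gradient_of (p : nat) (f : 'rV[R]_p -> R) (g : 'rV[R]_p -> 'rV[R]_p) :=
  forall x, differentiable f x /\ forall v, 'd f x v = dotv (g x) v.

Definition strongly_convex (p : nat) (mu : R) (f : 'rV[R]_p -> R) :=
  0 < mu /\
  forall (x y : 'rV[R]_p) (th : R), 0 <= th <= 1 ->
    f (th *: x + (1 - th) *: y) <=
      th * f x + (1 - th) * f y - mu / 2 * th * (1 - th) * sqn (x - y).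

(* l-smoothness: the gradient is l-Lipschitz (Euclidean norm) *)
Definition smooth (p : nat) (l : R) (g : 'rV[R]_p -> 'rV[R]_p) :=
  forall x y, Num.sqrt (sqn (g x - g y)) <= l * Num.sqrt (sqn (x - y)).

Definition laplacian (n : nat) (a : 'I_n -> 'I_n -> R) : 'M[R]_n :=
  \matrix_(i, j) ((i == j)%:R * (\sum_(k < n) a i k) - a i j).

Definition sym_part (n : nat) (M : 'M[R]_n) : 'M[R]_n := (2%:R)^-1 *: (M + M^T).

(* e is the second smallest eigenvalue (counted with multiplicity) of M:
   the characteristic polynomial splits over R with roots s sorted
   nondecreasingly, and e = s_1 (0-based). *)
Definition second_smallest_eig (n : nat) (M : 'M[R]_n) (e : R) :=
  exists s : seq R, sorted <=%R s /\
    char_poly M = \prod_(r <- s) ('X - r%:P) /\ e = nth 0 s 1.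

Definition nonneg_weights (n : nat) (a : 'I_n -> 'I_n -> R) := forall i j, 0 <= a i j.
Definition weight_balanced (n : nat) (a : 'I_n -> 'I_n -> R) :=
  forall i, \sum_(j < n) a j i = \sum_(j < n) a i j.
(* edge j -> i iff a_ij > 0 (agent i receives from agent j) *)
Definition strongly_connected (n : nat) (a : 'I_n -> 'I_n -> R) :=
  forall i j : 'I_n, connect (fun u v : 'I_n => 0 < a v u) i j.

Definition feasibleP (n p : nat) (b : 'rV[R]_p) (x : 'I_n -> 'rV[R]_p) :=
  \sum_(i < n) x i = b.
Definition optimalP (n p : nat) (f : 'I_n -> 'rV[R]_p -> R) (b : 'rV[R]_p)
  (x : 'I_n -> 'rV[R]_p) :=
  feasibleP b x /\ forall y, feasibleP b y ->
    \sum_(i < n) f i (x i) <= \sum_(i < n) f i (y i).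

(* (L (x) I_p) lam, agent i component: sum_j a_ij (lam_i - lam_j) *)
Definition lap_apply (n p : nat) (a : 'I_n -> 'I_n -> R) (lam : 'I_n -> 'rV[R]_p)
  (i : 'I_n) : 'rV[R]_p := \sum_(j < n) a i j *: (lam i - lam j).

Definition state_dist (n p : nat) (x y l1 l2 z1 z2 : 'I_n -> 'rV[R]_p) : R :=
  Num.sqrt (\sum_(i < n) (sqn (x i - y i) + sqn (l1 i - l2 i) + sqn (z1 i - z2 i))).

End Defs.

(* Main.v *)
Require Import Defs.
From HB Require Import structures.
From mathcomp Require Import all_boot all_order all_algebra.
From mathcomp Require Import all_classical all_reals all_analysis.
From mathcomp Require Import ring lra.
Import Order.TTheory GRing.Theory Num.Theory.
Import numFieldNormedType.Exports.
Local Open Scope classical_set_scope.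
Local Open Scope ring_scope.
Set Implicit Arguments. Unset Strict Implicit. Unset Printing Implicit Defensive.

(** At an optimal point xs all gradients g_i(xs_i) equal a common vector
    -lstar, so (xs, lstar, xs - bi) is an equilibrium. With X, L, Z the errors,
    m the average of L over the agents, P = L - m the disagreement and
    Y = Z + alpha P, the vectors Y and P sum to 0 over the agents and, for
      V = |X|^2/2 + |Y|^2/(2 alpha) + alpha |m|^2/2 + alpha |P|^2/2 + eps X.m
    (summed over the agents), the cross terms that cannot be bounded cancel:
      V' = - alpha X.G - |X - Y|^2 - alpha X.P + alpha^2 |P|^2
           - alpha beta P.(Lap P) + O(eps).
    The terms in P are absorbed by P.(Lap P) >= eta2 |P|^2, and the term eps X.m
    contributes the missing - eps alpha |m|^2/2. The hypotheses on alpha and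
    beta are used only through alpha mu >= 1 and beta eta2 >= 2 alpha.

    The spectral gap comes from minimizing the Rayleigh quotient of the symmetrized
    Laplacian on the orthogonal complement of (1, ..., 1): the minimum is an
    eigenvalue, and it is not 0 by connectivity. That eta2 itself is positive
    follows from 0 being a simple root of the characteristic polynomial. *)

(** * Euclidean row vectors and Rayleigh quotients *)

Section EuclideanRows.
Variables (R : realType) (p : nat).
Implicit Types u v w : 'rV[R]_p.

Lemma dotvC u v : dotv u v = dotv v u.
Proof. by apply: eq_bigr => k _; rewrite mulrC. Qed.

Lemma dotvDl u v w : dotv (u + v) w = dotv u w + dotv v w.
Proof. by rewrite -big_split /=; apply: eq_bigr => k _; rewrite mxE mulrDl. Qed.

Lemma dotvZl c u v : dotv (c *: u) v = c * dotv u v.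
Proof. by rewrite mulr_sumr; apply: eq_bigr => k _; rewrite mxE mulrA. Qed.

Lemma dotvDr u v w : dotv u (v + w) = dotv u v + dotv u w.
Proof. by rewrite dotvC dotvDl !(dotvC u). Qed.

Lemma dotvZr c u v : dotv u (c *: v) = c * dotv u v.
Proof. by rewrite dotvC dotvZl dotvC. Qed.

Lemma dotvNl u v : dotv (- u) v = - dotv u v.
Proof. by rewrite -scaleN1r dotvZl mulN1r. Qed.

Lemma dotvNr u v : dotv u (- v) = - dotv u v.
Proof. by rewrite dotvC dotvNl dotvC. Qed.

Lemma dotv0l u : dotv 0 u = 0.
Proof. by rewrite -(scale0r 0) dotvZl mul0r. Qed.

Lemma dotv0r u : dotv u 0 = 0.
Proof. by rewrite dotvC dotv0l. Qed.

Lemma dotv_suml I (r : seq I) P (F : I -> 'rV[R]_p) v :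
  dotv (\sum_(i <- r | P i) F i) v = \sum_(i <- r | P i) dotv (F i) v.
Proof.
by elim/big_rec2: _ => [|i y x _ <-]; rewrite ?dotv0l ?dotvDl.
Qed.

Definition dotvE := (dotvDl, dotvDr, dotvNl, dotvNr, dotvZl, dotvZr).

Lemma sqn_ge0 u : 0 <= sqn u.
Proof. by apply: sumr_ge0 => k _; rewrite -expr2 sqr_ge0. Qed.

Lemma sqn_eq0 u : sqn u = 0 -> u = 0.
Proof.
move=> /eqP; rewrite psumr_eq0 => [/allP u0|k _]; last first.
  by rewrite -expr2 sqr_ge0.
apply/rowP => k; rewrite mxE; apply/eqP.
by have := u0 k (mem_index_enum k); rewrite mulf_eq0 orbb.
Qed.

Lemma sqn_gt0 u : u != 0 -> 0 < sqn u.
Proof.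
move=> u0; rewrite lt_neqAle sqn_ge0 andbT eq_sym.
by apply: contra u0 => /eqP /sqn_eq0 ->.
Qed.

Lemma sqnZ c u : sqn (c *: u) = c ^+ 2 * sqn u.
Proof. by rewrite /sqn dotvZl dotvZr mulrA expr2. Qed.

Lemma sqnD u v : sqn (u + v) = sqn u + 2 * dotv u v + sqn v.
Proof. by rewrite /sqn !dotvE (dotvC v u); ring. Qed.

End EuclideanRows.

Lemma dotv_mulmx (R : realType) (n : nat) (M : 'M[R]_n) (u v : 'rV[R]_n) :
  dotv (u *m M) v = dotv u (v *m M^T).
Proof.
have dE (x y : 'rV[R]_n) : dotv x y = (x *m y^T) 0 0.
  by rewrite mxE; apply: eq_bigr => k _; rewrite mxE.
by rewrite !dE trmx_mul trmxK mulmxA.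
Qed.

Lemma cvg_sumv (R : realType) (V : normedModType R) (T : Type)
    (F : set_system T) {FF : Filter F} (I : Type) (r : seq I) (P : pred I)
    (f : I -> T -> V) (l : I -> V) :
  (forall i, P i -> f i x @[x --> F] --> l i) ->
  \sum_(i <- r | P i) f i x @[x --> F] --> \sum_(i <- r | P i) l i.
Proof. by move=> fl; apply: cvg_big => //; exact: add_continuous. Qed.

Lemma cvg_coord (R : realType) (T : Type) (F : set_system T) {FF : Filter F}
    (p : nat) (f : T -> 'rV[R]_p) (u : 'rV[R]_p) (k : 'I_p) :
  f x @[x --> F] --> u -> f x 0 k @[x --> F] --> u 0 k.
Proof.
move=> fu; apply: (cvg_comp f (fun v : 'rV[R]_p => v 0 k) fu).
exact: coord_continuous.
Qed.

Lemma cvg_dotv (R : realType) (T : Type) (F : set_system T) {FF : Filter F}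
    (p : nat) (f g : T -> 'rV[R]_p) (u v : 'rV[R]_p) :
  f x @[x --> F] --> u -> g x @[x --> F] --> v ->
  dotv (f x) (g x) @[x --> F] --> dotv u v.
Proof. by move=> fu gv; apply: (@cvg_sumv R R) => k _; apply: cvgM; exact: cvg_coord. Qed.

(** The unit vectors orthogonal to [u] form a nonempty compact set, so the quadratic form attains
    its minimum there. As [M] is symmetric and kills [u], it maps the complement of [u] into itself,
    and stationarity of the minimizer is a true eigenvalue equation. *)
Lemma rayleigh_min_eigenvector (R : realType) (n : nat) (M : 'M[R]_n)
    (u w : 'rV[R]_n) :
  M^T = M -> u *m M = 0 -> dotv u w = 0 -> w != 0 ->
  exists m, exists2 v : 'rV[R]_n, v != 0 &
    [/\ dotv u v = 0, v *m M = m *: v &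
        forall y, dotv u y = 0 -> m * sqn y <= dotv (y *m M) y].
Proof.
move=> Msym uM uw w0.
pose S : set 'rV[R]_n := [set v | sqn v = 1 /\ dotv u v = 0].
have normS y : dotv u y = 0 -> y != 0 -> S ((Num.sqrt (sqn y))^-1 *: y).
  move=> uy y0; split; last by rewrite dotvZr uy mulr0.
  by rewrite sqnZ exprVn sqr_sqrtr ?sqn_ge0// mulVf// gt_eqF// sqn_gt0.
have csqn : continuous (@sqn R n) 
  by move=> v; apply: (@cvg_dotv R _ (nbhs v) _ n id id); exact: cvg_id.
have cu : continuous (fun v : 'rV[R]_n => dotv u v).
  move=> v; apply: (@cvg_dotv R _ (nbhs v) _ n (cst u) id); last exact: cvg_id.
  exact: cvg_cst.
have cq : continuous (fun v : 'rV[R]_n => dotv (v *m M) v).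
  move=> v; apply: (@cvg_sumv R R _ (nbhs v)) => k _.
  apply: cvgM; last exact: coord_continuous.
  rewrite mxE; under eq_fun do rewrite mxE.
  apply: (@cvg_sumv R R _ (nbhs v)) => j _; apply: cvgM; last exact: cvg_cst.
  exact: coord_continuous.
have Sclosed : closed S.
  have -> : S = @sqn R n @^-1` [set 1] `&` (fun v => dotv u v) @^-1` [set 0].
    by apply/seteqP; split.
  by apply: closedI; (apply: preimage_closed; last exact: closed_eq);
    move=> v _; [exact: csqn|exact: cu].
have Scompact : compact S.
  apply: (@subclosed_compact _ _
    [set v : 'rV[R]_n | forall i, `[-1, 1]%classic (v ord0 i)]) => //.
    apply: (@rV_compact R n (fun=> `[-1, 1]%classic)) => i.
    exact: segment_compact.
  move=> v [v1 _] i /=; rewrite in_itv /= -ler_norml.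
  rewrite -(@ler_pXn2r _ 2) ?nnegrE// expr1n real_normK ?num_real// -v1.
  rewrite /sqn /dotv (bigD1 i)//= -expr2 lerDl.
  by apply: sumr_ge0 => k _; rewrite -expr2 sqr_ge0.
have [c /set_mem [c1 uc] cmin] := EVT_min_rV (ex_intro _ _ (normS w uw w0))
  Scompact (continuous_subspaceT cq).
pose m := dotv (c *m M) c.
have qmin y : dotv u y = 0 -> m * sqn y <= dotv (y *m M) y.
  move=> uy; have [->|y0] := eqVneq y 0.
    by rewrite mul0mx /sqn !dotv0l mulr0.
  have := cmin _ (mem_set (normS y uy y0)).
  rewrite -/m -scalemxAl dotvZl dotvZr mulrA -expr2 exprVn.
  by rewrite sqr_sqrtr ?sqn_ge0// mulrC ler_pdivlMr// sqn_gt0.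
exists m, c; first by apply: contra_eq_neq c1 => ->; rewrite /sqn dotv0l eq_sym oner_neq0.
split=> //.
(* The residual r of the eigenvalue equation is an admissible direction, and the
   first variation of the Rayleigh quotient along r is |r|^2. *)
have [r rdef] : exists r, r = c *m M - m *: c by eexists.
have ur : dotv u r = 0.
  by rewrite rdef !dotvE uc mulr0 subr0 dotvC dotv_mulmx Msym uM dotv0r.
apply/eqP; rewrite -subr_eq0 -rdef; apply/negPn/negP => /sqn_gt0 rr.
have [K Kge] : exists K, `|dotv (r *m M) r - m * sqn r| <= K by eexists.
have K0 : 0 <= K by apply: le_trans Kge.
have variation t : 0 <= 2 * t * sqn r + t ^+ 2 * K.
  have := qmin (c + t *: r); rewrite dotvDr dotvZr uc ur mulr0 addr0 => /(_ erefl).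
  rewrite mulmxDl -scalemxAl sqnD sqnZ c1 !dotvE -/m.
  rewrite [dotv (r *m M) c]dotv_mulmx Msym (dotvC r (c *m M)).
  have rE : sqn r = dotv (c *m M) r - m * dotv c r.
    by rewrite -dotvZl -dotvNl -dotvDl -rdef.
  have := ler_wpM2l (sqr_ge0 t) (le_trans (ler_norm _) Kge).
  rewrite [X in 2 * t * X]rE /sqn; lra.
(* With tau = |r|^2 / (K + 1), the variation at t = - tau is - (K + 2) tau^2 < 0, a
   contradiction. *)
have := variation (- (sqn r / (K + 1))).
have K1 : 0 < K + 1 by lra.
have t0 : 0 < sqn r / (K + 1) by exact: divr_gt0.
have : sqn r / (K + 1) * (K + 1) = sqn r by rewrite divfK// gt_eqF.
nra.
Qed.

(** * Simple zero root of the characteristic polynomial and the spectral gap *)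

(** The columns of [M] sum to 0, so ['X] factors out of the determinant. The cofactor at 0 is the
    determinant of [- M] with row 0 replaced by ones; a vector killed by that matrix has sum 0 and
    lies in the kernel that [kerM] makes trivial. *)
Lemma char_poly_simple_root0 (R : fieldType) (n : nat) (M : 'M[R]_n.+1) :
  const_mx 1 *m M = 0 :> 'rV_n.+1 ->
  (forall v : 'rV_n.+1, v *m M^T = 0 -> \sum_i v 0 i = 0 -> v = 0) ->
  exists2 Q : {poly R}, char_poly M = 'X * Q & Q.[0] != 0.
Proof.
move=> oneM kerM.
(* Adding all rows of XI - M to row 0 turns that row into (X, ..., X). *)
pose N : 'M[{poly R}]_n.+1 :=
  \matrix_(i, j) if i == 0 then 1 else char_poly_mx M i j.
pose E : 'M[{poly R}]_n.+1 :=
  \matrix_(i, j) if i == 0 then 1 else (i == j)%:R.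
pose D : 'rV[{poly R}]_n.+1 := \row_i if i == 0 then 'X else 1.
have EDN : E *m char_poly_mx M = diag_mx D *m N.
  apply/matrixP => i j; rewrite mul_diag_mx !mxE.
  case: ifPn => i0.
    under eq_bigr do rewrite mxE i0 mul1r !mxE.
    rewrite big_split /= (bigD1 j)//= eqxx big1 => [|k /negPf ->]; last by rewrite mulr0n.
    rewrite addr0 sumrN -raddf_sum /= mulr1.
    have -> : \sum_i M i j = 0.
      have /rowP/(_ j) := oneM; rewrite !mxE; apply: etrans.
      by apply: eq_bigr => i1 _; rewrite mxE mul1r.
    by rewrite subr0.
  rewrite mul1r (bigD1 i)//= mxE (negPf i0) eqxx mul1r big1 ?addr0 ?mxE// => k.
  by rewrite eq_sym mxE (negPf i0) => /negPf ->; rewrite mul0r.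
have detE : \det E = 1.
  rewrite -det_tr det_trig.
    by apply: big1 => i _; rewrite !mxE eqxx; case: ifP.
  apply/is_trig_mxP => i j ij; rewrite !mxE.
  have /negPf -> : j != 0 by rewrite -val_eqE /= -lt0n (leq_ltn_trans _ ij).
  by have /negPf -> : j != i by rewrite -val_eqE /= neq_ltn ij orbT.
have detD : \det (diag_mx D) = 'X.
  rewrite det_diag (bigD1 0)//= mxE eqxx big1 ?mulr1// => i i0.
  by rewrite mxE (negPf i0).
exists (\det N).
  by rewrite -detD -det_mulmx -EDN det_mulmx detE mul1r.
rewrite -[_.[0]]/(horner_eval 0 (\det N)) -det_map_mx -det_tr.
apply/det0P => -[v v0 vN].
move/eqP: v0; apply.
have sumv : \sum_i v 0 i = 0.
  have /rowP/(_ 0) := vN; rewrite !mxE; apply: etrans; apply: eq_bigr => i _.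
  by rewrite !mxE eqxx /= /horner_eval hornerC mulr1.
have vM i : i != 0 -> (v *m M^T) 0 i = 0.
  move=> i0; have /rowP/(_ i) := vN; rewrite !mxE => /(congr1 -%R).
  rewrite oppr0 -sumrN; apply: etrans; apply: eq_bigr => j _.
  rewrite !mxE (negPf i0) /= /horner_eval hornerD hornerN hornerC.
  by rewrite hornerMn hornerX mul0rn sub0r mulrN opprK.
apply: kerM => //; apply/rowP => i; rewrite [RHS]mxE.
have [->|] := eqVneq i 0; last exact: vM.
(* Row 0 of [N] says nothing about entry 0 of [v *m M^T]. All entries together sum to 0 because the
   columns of [M] do, so this one vanishes with the others. *)
have : (v *m M^T *m (const_mx 1 : 'rV_n.+1)^T) 0 0 = 0.
  by rewrite -mulmxA -trmx_mul oneM trmx0 mulmx0 mxE.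
rewrite mxE (bigD1 0)//= big1 => [|j j0]; last by rewrite vM// mul0r.
by rewrite !mxE mulr1 addr0.
Qed.

(** Semidefiniteness puts the root 0 first in the sorted list, and its simplicity makes [e]
    positive. The Rayleigh minimum on the complement of the ones vector is a nonzero eigenvalue,
    hence one of the later roots and at least [e]. *)
Lemma second_smallest_eig_gap (R : realType) (n : nat) (M : 'M[R]_n) (e : R) :
  (2 <= n)%N -> M^T = M -> const_mx 1 *m M = 0 :> 'rV_n ->
  (forall v : 'rV_n, 0 <= dotv (v *m M) v) ->
  (forall v : 'rV_n, dotv (v *m M) v = 0 -> \sum_i v 0 i = 0 -> v = 0) ->
  second_smallest_eig M e ->
  0 < e /\ forall v : 'rV_n, \sum_i v 0 i = 0 -> e * sqn v <= dotv (v *m M) v.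
Proof.
case: n M => [|[|n]] // M _ Msym oneM Mpsd Mker [s [s_sorted [sE ->]]].
have dot1 (v : 'rV[R]_n.+2) : dotv (const_mx 1) v = \sum_i v 0 i.
  by apply: eq_bigr => i _; rewrite mxE mul1r.
have rootE r : root (char_poly M) r = (r \in s) by rewrite sE root_prod_XsubC.
have eig_ge0 r : r \in s -> 0 <= r.
  rewrite -rootE -eigenvalue_root_char => /eigenvalueP [v vM v0].
  have := Mpsd v; rewrite vM dotvZl -/(sqn v) => h.
  by rewrite -(pmulr_lge0 _ (sqn_gt0 v0)).
have s0 : 0 \in s.
  rewrite -rootE -eigenvalue_root_char; apply/eigenvalueP.
  exists (const_mx 1); first by rewrite scale0r.
  by apply/eqP => /rowP /(_ 0) /eqP; rewrite !mxE oner_eq0.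
have size_s : size s = n.+2.
  by apply: succn_inj; rewrite -(size_char_poly M) sE size_prod_XsubC.
case: s s_sorted sE rootE eig_ge0 s0 size_s => [|r0 [|r1 s]] //=.
move=> /andP [r01 r1s] sE rootE eig_ge0 s0 _.
(* A second zero root would leave a factor ['X] in the cofactor, which does not vanish at 0. *)
have r1_gt0 : 0 < r1.
  rewrite lt_neqAle eig_ge0 ?inE ?eqxx ?orbT// andbT; apply/negP => /eqP r10.
  have r00 : r0 = 0 by apply/eqP; rewrite eq_le [X in _ <= X]r10 r01 eig_ge0// inE eqxx.
  have [|Q] := @char_poly_simple_root0 R n.+1 M oneM.
    move=> v; rewrite Msym => vM; apply: Mker.
    by rewrite vM dotv0l.
  rewrite sE !big_cons r00 -r10 subr0 => /(mulfI (negbT (polyX_eq0 _))) <-.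
  by rewrite hornerM hornerX mul0r eqxx.
split=> // v v1.
pose w : 'rV[R]_n.+2 := delta_mx 0 0 - delta_mx 0 1.
have [] := @rayleigh_min_eigenvector R n.+2 M (const_mx 1) w Msym oneM.
- rewrite dot1; under eq_bigr do rewrite !mxE eqxx /=.
  rewrite sumrB (bigD1 0)//= (bigD1 1 (F := fun i => (i == 1)%:R))//=.
  by rewrite !big1 ?addr0 ?subrr// => i /negPf ->.
- by apply/eqP => /rowP /(_ 0) /eqP; rewrite !mxE /= subr0 oner_eq0.
move=> m [c c0 [c1 cM cmin]].
rewrite dot1 in c1.
have ms : m \in r0 :: r1 :: s.
  by rewrite -rootE -eigenvalue_root_char; apply/eigenvalueP; exists c.
have m0 : m != 0.
  apply: contra c0 => /eqP m0; apply/eqP/Mker => //.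
  by rewrite cM m0 scale0r dotv0l.
have le_r1 x : x \in r1 :: s -> r1 <= x.
  rewrite inE => /predU1P [->//|].
  exact/allP/(order_path_min le_trans r1s).
have r00 : r0 = 0.
  by move: s0; rewrite inE => /predU1P [//|/le_r1]; rewrite leNgt r1_gt0.
have r1m : r1 <= m.
  by apply: le_r1; move: ms; rewrite inE r00 (negPf m0).
by apply: le_trans (cmin v _); rewrite ?dot1// ler_wpM2r// sqn_ge0.
Qed.

(** * Graph Laplacian *)

(** The total coefficient of [lam i] is a row sum minus a column sum of the weights, which cancel by
    balance. *)
Lemma sum_lap_apply (R : realType) (n p : nat) (a : 'I_n -> 'I_n -> R)
    (lam : 'I_n -> 'rV[R]_p) :
  weight_balanced a -> \sum_i lap_apply a lam i = 0.
Proof.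
move=> bal; rewrite /lap_apply.
under eq_bigr do under eq_bigr do rewrite scalerBr.
under eq_bigr do rewrite sumrB -scaler_suml.
rewrite sumrB exchange_big /=.
apply/eqP; rewrite subr_eq0; apply/eqP/eq_bigr => i _.
by rewrite -scaler_suml bal.
Qed.

Section GraphLaplacian.
Variables (R : realType) (n : nat) (a : 'I_n -> 'I_n -> R).
Hypotheses (bal : weight_balanced a) (a_ge0 : nonneg_weights a).
Let M := sym_part (laplacian a).

Lemma sym_part_tr : M^T = M.
Proof. by apply/matrixP => i j; rewrite !mxE addrC. Qed.

Lemma laplacian_quad (v : 'rV[R]_n) :
  dotv (v *m M) v = \sum_i v 0 i * \sum_j a i j * (v 0 i - v 0 j).
Proof.
(* A matrix and its transpose have the same quadratic form, so symmetrizing does not change it. *)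
have -> : dotv (v *m M) v = dotv v (v *m (laplacian a)^T).
  rewrite /M /sym_part -scalemxAr mulmxDr dotvZl dotvDl dotv_mulmx.
  by rewrite [dotv _ v in X in _ + X]dotvC; field.
apply: eq_bigr => i _; rewrite mxE; congr (_ * _).
under [LHS]eq_bigr do rewrite !mxE mulrBr.
under [RHS]eq_bigr do rewrite mulrBr.
rewrite !sumrB (bigD1 i)//= eqxx mul1r [X in _ + X - _]big1 => [|j]; last first.
  by rewrite eq_sym => /negPf ->; rewrite mul0r mulr0.
rewrite addr0 mulr_sumr; congr (_ - _); apply: eq_bigr => j _; exact: mulrC.
Qed.

(** Balance equates the weighted sums of squares at the two ends of the edges, which turns the
    quadratic form into the Dirichlet energy of the graph. *)
Lemma laplacian_quad_sqr (v : 'rV[R]_n) :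
  dotv (v *m M) v = 2^-1 * \sum_i \sum_j a i j * (v 0 i - v 0 j) ^+ 2.
Proof.
have balE : \sum_i \sum_j a i j * v 0 j ^+ 2 = \sum_i \sum_j a i j * v 0 i ^+ 2.
  rewrite exchange_big /=; apply: eq_bigr => i _.
  by rewrite -!mulr_suml bal.
have -> : \sum_i \sum_j a i j * (v 0 i - v 0 j) ^+ 2 =
    2 * \sum_i \sum_j a i j * v 0 i ^+ 2
    - 2 * \sum_i \sum_j a i j * (v 0 i * v 0 j).
  rewrite [2 * \sum_i \sum_j _ * _ ^+ 2]mulr_natl mulr2n -{2}balE.
  rewrite mulr_sumr -!big_split -sumrB /=; apply: eq_bigr => i _.
  rewrite mulr_sumr -!big_split -sumrB /=; apply: eq_bigr => j _; ring.
rewrite -mulrBr mulKf ?pnatr_eq0// laplacian_quad -sumrB; apply: eq_bigr => i _.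
rewrite mulr_sumr -sumrB; apply: eq_bigr => j _; ring.
Qed.

Lemma const_mul_laplacian : const_mx 1 *m M = 0 :> 'rV_n.
Proof.
apply/rowP => j; rewrite !mxE.
under eq_bigr do rewrite !mxE mul1r.
have delta F : \sum_i (i == j)%:R * F i = F j :> R.
  rewrite (bigD1 j)//= eqxx mul1r big1 ?addr0// => i /negPf ->.
  by rewrite mul0r.
rewrite -mulr_sumr big_split /= !sumrB bal delta.
under [X in _ + (X - _)]eq_bigr do rewrite eq_sym.
by rewrite (delta (fun=> _)) !subrr addr0 mulr0.
Qed.

Lemma laplacian_quad_ge0 (v : 'rV[R]_n) : 0 <= dotv (v *m M) v.
Proof.
rewrite laplacian_quad_sqr mulr_ge0 ?invr_ge0 ?ler0n//.
by do 2![apply: sumr_ge0 => ? _]; rewrite mulr_ge0 ?sqr_ge0.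
Qed.

(** Zero energy forces equal values along each edge, hence along directed paths, so [v] is
    constant. *)
Lemma laplacian_quad_eq0 (v : 'rV[R]_n) : strongly_connected a ->
  dotv (v *m M) v = 0 -> \sum_i v 0 i = 0 -> v = 0.
Proof.
move=> conn; rewrite laplacian_quad_sqr => /eqP.
rewrite mulf_eq0 invr_eq0 pnatr_eq0 /= psumr_eq0 => [/allP h|i _]; last first.
  by apply: sumr_ge0 => j _; rewrite mulr_ge0 ?sqr_ge0.
have edge i j : 0 < a i j -> v 0 i = v 0 j.
  move=> aij; have := h i (mem_index_enum i).
  rewrite psumr_eq0 => [/allP /(_ j (mem_index_enum j))|k _]; last first.
    by rewrite mulr_ge0 ?sqr_ge0.
  by rewrite mulf_eq0 gt_eqF//= sqrf_eq0 subr_eq0 => /eqP.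
have vE i j : v 0 i = v 0 j.
  have /connectP [s + ->] := conn i j.
  elim: s i => //= k s IH i /andP [ki /IH <-]; exact/esym/edge.
move=> v1; apply/rowP => i; rewrite mxE; move: v1.
under eq_bigr do rewrite (vE _ i); rewrite sumr_const card_ord => /eqP.
by rewrite mulrn_eq0 -leqn0 leqNgt (leq_ltn_trans _ (ltn_ord i)) //= => /eqP.
Qed.

Lemma lap_apply_gap (e : R) : (2 <= n)%N -> strongly_connected a ->
  second_smallest_eig M e ->
  0 < e /\ forall p (lam : 'I_n -> 'rV[R]_p), \sum_i lam i = 0 ->
    e * \sum_i sqn (lam i) <= \sum_i dotv (lam i) (lap_apply a lam i).
Proof.
move=> n2 conn eigM.
have [e0 gap] := second_smallest_eig_gap n2 sym_part_tr const_mul_laplacian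
  laplacian_quad_ge0 (fun v => laplacian_quad_eq0 conn) eigM.
split=> // p lam lam0.
(* Both sides split over the [p] coordinates, and the scalar gap applies to each coordinate slice of
   [lam]. *)
rewrite exchange_big [leRHS]exchange_big /= mulr_sumr; apply: ler_sum => k _.
have v0 : \sum_i (\row_i lam i 0 k) 0 i = 0.
  apply: (etrans (y := (\sum_i lam i) 0 k)); last by rewrite lam0 mxE.
  by rewrite summxE; apply: eq_bigr => i _; rewrite mxE.
have := gap _ v0; rewrite laplacian_quad.
set A := (X in e * X <= _); set B := (X in _ <= X) => AB.
rewrite (_ : \sum_j _ = A); last by apply: eq_bigr => i _; rewrite mxE.
rewrite (_ : \sum_j _ = B) //; apply: eq_bigr => i _; rewrite mxE; congr (_ * _).
by rewrite summxE; apply: eq_bigr => j _; rewrite !mxE.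
Qed.

End GraphLaplacian.

(** * Convexity and optimality *)

Section GradientOfConvex.
Variables (R : realType) (p : nat).
Implicit Types (f : 'rV[R]_p -> R) (g : 'rV[R]_p -> 'rV[R]_p).

Lemma gradient_quotient_cvg f g (x v : 'rV[R]_p) : gradient_of f g ->
  h^-1 * (f (h *: v + x) - f x) @[h --> 0^'+] --> dotv (g x) v.
Proof.
move=> fg; have [df dfE] := fg x.
rewrite -dfE -deriveE//.
apply: cvg_dnbhs_at_right; exact: diff_derivable.
Qed.

(** Strong convexity with weight h on [y], divided by h, leaves a factor [1 - h] on the quadratic
    term; then h tends to 0 from the right. *)
Lemma strongly_convex_gradient f g mu (x y : 'rV[R]_p) :
  gradient_of f g -> strongly_convex mu f ->
  f x + dotv (g x) (y - x) + mu / 2 * sqn (y - x) <= f y.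
Proof.
move=> fg [mu0 fconv].
suff : dotv (g x) (y - x) <= f y - f x - mu / 2 * sqn (y - x) by lra.
have rhs : f y - f x - mu / 2 * (1 - h) * sqn (y - x) @[h --> 0^'+] -->
    f y - f x - mu / 2 * (1 - 0) * sqn (y - x).
  apply: cvgB; first exact: cvg_cst.
  apply: cvgM; last exact: cvg_cst.
  apply: cvgM; first exact: cvg_cst.
  apply: cvgB; first exact: cvg_cst.
  exact: cvg_at_right_filter.
rewrite -[X in X * sqn _](mulr1) -{2}(subr0 1).
apply: (ler_cvg_to (gradient_quotient_cvg (v := y - x) (x := x) fg) rhs).
near=> h.
have h0 : 0 < h by near: h; exact: nbhs_right_gt.
have h1 : h < 1 by near: h; apply: nbhs_right_lt.
rewrite ler_pdivrMl//.
have := fconv y x h; rewrite (ltW h0) (ltW h1) => /(_ isT).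
have -> : h *: y + (1 - h) *: x = h *: (y - x) + x.
  by apply/rowP => k; rewrite !mxE; ring.
lra.
Unshelve. all: by end_near. Qed.

Lemma gradient_strongly_monotone f g mu (x y : 'rV[R]_p) :
  gradient_of f g -> strongly_convex mu f ->
  mu * sqn (x - y) <= dotv (g x - g y) (x - y).
Proof.
move=> fg fconv.
have := strongly_convex_gradient x y fg fconv.
have := strongly_convex_gradient y x fg fconv.
rewrite -(opprB x y) /sqn !dotvE; lra.
Qed.

Lemma smooth_sqn g l lm (x y : 'rV[R]_p) : smooth lm g -> lm <= l ->
  sqn (g x - g y) <= l ^+ 2 * sqn (x - y).
Proof.
move=> gl lml; have gxy : Num.sqrt (sqn (g x - g y)) <= l * Num.sqrt (sqn (x - y)).
  by apply: le_trans (gl x y) _; rewrite ler_wpM2r ?sqrtr_ge0.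
rewrite -[sqn (g x - g y)]sqr_sqrtr ?sqn_ge0// -[sqn (x - y)]sqr_sqrtr ?sqn_ge0//.
by rewrite -exprMn ler_sqr ?nnegrE ?sqrtr_ge0// (le_trans _ gxy) ?sqrtr_ge0.
Qed.

End GradientOfConvex.

Section Optimality.
Variables (R : realType) (n p : nat).
Variables (f : 'I_n -> 'rV[R]_p -> R) (g : 'I_n -> 'rV[R]_p -> 'rV[R]_p).
Variable b : 'rV[R]_p.
Hypothesis fg : forall i, gradient_of (f i) (g i).

(** Moving [h *: v] from agent [j] to agent [i] keeps the point feasible. For [v] the difference of
    the two gradients, the objective has slope - |v|^2 in that direction, and optimality makes this
    slope nonnegative. *)
Lemma optimal_gradients_eq (x : 'I_n -> 'rV[R]_p) (i j : 'I_n) :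
  optimalP f b x -> g i (x i) = g j (x j).
Proof.
move=> [xb xopt]; have [->//|ij] := eqVneq i j.
pose v := g j (x j) - g i (x i).
apply/eqP; rewrite eq_sym -subr_eq0 -/v; apply/eqP/sqn_eq0/eqP.
rewrite eq_le sqn_ge0 andbT.
suff : 0 <= dotv (g i (x i)) v + dotv (g j (x j)) (- v).
  have -> : sqn v = dotv (g j (x j)) v - dotv (g i (x i)) v.
    by rewrite -dotvNl -dotvDl.
  by rewrite dotvNr; lra.
have cvg := cvgD (gradient_quotient_cvg (x := x i) (v := v) (fg i))
  (gradient_quotient_cvg (x := x j) (v := - v) (fg j)).
apply: (@cvgr_to_ge _ _ _ R _ _ 0 (cvg _)); near=> h.
have h0 : 0 < h by near: h; exact: nbhs_right_gt.
pose w := h *: v.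
pose y k := x k + (k == i)%:R *: w - (k == j)%:R *: w.
have delta k0 : \sum_k (k == k0)%:R *: w = w :> 'rV[R]_p.
  rewrite (bigD1 k0)//= eqxx scale1r big1 ?addr0// => k /negPf ->.
  by rewrite scale0r.
have yb : feasibleP b y.
  by rewrite /feasibleP sumrB big_split /= !delta xb addrK.
have ji : j != i by rewrite eq_sym.
have yi : y i = h *: v + x i.
  by rewrite /y eqxx (negPf ij) scale1r scale0r subr0 addrC.
have yj : y j = h *: - v + x j.
  by rewrite /y eqxx (negPf ji) scale1r scale0r addr0 scalerN addrC.
have yk k : k != i -> k != j -> y k = x k.
  by move=> /negPf ki /negPf kj; rewrite /y ki kj !scale0r addr0 subr0.
have := xopt y yb.
rewrite (bigD1 i)//= [X in _ <= X -> _](bigD1 i)//=.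
rewrite (bigD1 j)//= [X in _ <= _ + X -> _](bigD1 j)//=.
rewrite yi yj [X in _ <= _ + (_ + X) -> _](eq_bigr (fun k => f k (x k))); last first.
  by move=> k /andP [ki kj]; rewrite yk.
move=> fxy; rewrite -[leRHS]/(h^-1 * (f i (h *: v + x i) - f i (x i))
  + h^-1 * (f j (h *: - v + x j) - f j (x j))).
by rewrite -mulrDr mulr_ge0 ?invr_ge0 ?(ltW h0)//; lra.
Unshelve. all: by end_near. Qed.

(** In the strongly convex lower bounds at [x], the linear terms cancel: the gradients coincide and
    both points sum to [b]. Only the quadratic gap remains. *)
Lemma optimal_unique (mu : 'I_n -> R) (x y : 'I_n -> 'rV[R]_p) :
  (forall i, strongly_convex (mu i) (f i)) ->
  optimalP f b x -> optimalP f b y -> y = x.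
Proof.
move=> fconv xopt [yb yopt]; have [xb _] := xopt.
have gap : \sum_i mu i / 2 * sqn (y i - x i) <= 0.
  have := yopt x xb.
  have : \sum_i (f i (x i) + dotv (g i (x i)) (y i - x i)
      + mu i / 2 * sqn (y i - x i)) <= \sum_i f i (y i).
    by apply: ler_sum => i _; exact: strongly_convex_gradient.
  rewrite !big_split /= (_ : \sum_i dotv _ _ = 0); first by lra.
  (* Without agents there is no common gradient to name, but the sum is empty. *)
  case: (pickP 'I_n) => [i0 _|no]; last by apply: big1 => i; have := no i.
  under eq_bigr do rewrite (optimal_gradients_eq _ i0 xopt) dotvC.
  by rewrite -dotv_suml sumrB xb yb subrr dotv0l.
have term_ge0 i : 0 <= mu i / 2 * sqn (y i - x i).
  by rewrite mulr_ge0 ?sqn_ge0// divr_ge0// ltW// (fconv i).1.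
apply/funext => i; apply/eqP; rewrite -subr_eq0; apply/eqP/sqn_eq0/eqP.
have /eqP : \sum_i mu i / 2 * sqn (y i - x i) = 0.
  by apply/eqP; rewrite eq_le gap sumr_ge0.
rewrite psumr_eq0// => /allP /(_ i (mem_index_enum i)).
by rewrite !mulf_eq0 invr_eq0 pnatr_eq0 orbF gt_eqF// (fconv i).1.
Qed.

End Optimality.

(** * Curves and exponential decay *)

Section Curves.
Variables (R : realType) (p : nat).

Lemma is_derive_coord (u : R -> 'rV[R]_p) (t : R) (du : 'rV[R]_p) (k : 'I_p) :
  is_derive t 1 u du -> is_derive t 1 (fun s => u s 0 k) (du 0 k).
Proof.
move=> [diff_u <-]; apply: DeriveDef; first exact: (derivable_mxP u t 1).1.
by rewrite derive_mx// mxE.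
Qed.

Lemma is_derive_sumf (V : normedModType R) (n : nat) (h : 'I_n -> R -> V)
    (t : R) (dh : 'I_n -> V) :
  (forall i, is_derive t 1 (h i) (dh i)) ->
  is_derive t 1 (fun s => \sum_i h i s) (\sum_i dh i).
Proof.
move=> hd; rewrite (_ : (fun s => _) = \sum_i h i); first exact: is_derive_sum.
by apply/funext => s; rewrite fct_sumE.
Qed.

Lemma is_derive_dotv (u v : R -> 'rV[R]_p) (t : R) (du dv : 'rV[R]_p) :
  is_derive t 1 u du -> is_derive t 1 v dv ->
  is_derive t 1 (fun s => dotv (u s) (v s)) (dotv du (v t) + dotv (u t) dv).
Proof.
move=> hu hv; rewrite -big_split /=.
apply: is_derive_sumf => k.
apply: (is_derive_eq (is_deriveM (is_derive_coord k hu) (is_derive_coord k hv))).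
by rewrite addrC [_ *: du 0 k]mulrC.
Qed.

Lemma is_derive_sqn (u : R -> 'rV[R]_p) (t : R) (du : 'rV[R]_p) :
  is_derive t 1 u du -> is_derive t 1 (fun s => sqn (u s)) (2 * dotv (u t) du).
Proof.
move=> hu; apply: (is_derive_eq (is_derive_dotv hu hu)).
by rewrite (dotvC du); ring.
Qed.

(** Integrating factor: [V s * expR (c * s)] is nonincreasing for positive times, and right
    continuity carries the comparison back to time 0. *)
Lemma exponential_decay (V dV : R -> R) (c : R) :
  (forall t : R, 0 < t -> is_derive t 1 V (dV t)) ->
  (forall t : R, 0 < t -> dV t <= - c * V t) ->
  V s @[s --> 0^'+] --> V 0 ->
  forall t : R, 0 <= t -> V t <= V 0 * expR (- (c * t)).
Proof.
move=> V' V'le V0 t t0.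
pose W s := V s * expR (c * s).
have cE : continuous (fun s : R => expR (c * s)).
  move=> s; apply: continuous_comp; last exact: continuous_expR.
  exact: mulrl_continuous.
have W' (s : R) : 0 < s -> is_derive s 1 W ((dV s + c * V s) * expR (c * s)).
  move=> s0; have hV := V' s s0.
  have hE : is_derive s 1 (fun r : R => expR (c * r)) (c * expR (c * s)).
    have hc : is_derive s 1 (fun r : R => c * r) c.
      by apply: (is_derive_eq (is_deriveZ c (is_derive_id s 1))); exact: mulr1.
    apply: (is_derive_eq (is_derive1_comp (is_derive_expR (c * s)) hc)).
    exact: mulrC.
  apply: (is_derive_eq (is_deriveM hV hE)); rewrite /GRing.scale /=; ring.
have W0 : derivable_oy_Rcontinuous W 0.
  split; first by move=> s; rewrite in_itv /= andbT => /W' [].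
  by apply: cvgM => //; apply: cvg_at_right_filter; exact: cE.
have : W t <= W 0.
  apply: (@ler0_derive1_nincry R W 0) => //.
  - by move=> s; rewrite in_itv /= andbT => /W' [].
  - move=> s; rewrite in_itv /= andbT => s0.
    rewrite derive1E (@derive_val _ _ _ _ _ _ _ (W' s s0)).
    by rewrite mulr_le0_ge0 ?expR_ge0//; have := V'le s s0; lra.
  - exact: derivable_oy_Rcontinuous_within_itvcy.
by rewrite /W mulr0 expR0 mulr1 expRN ler_pdivlMr ?expR_gt0.
Qed.

(** Decay at rate 0 bounds each coordinate and its opposite by their initial values. *)
Lemma constant_of_derive0 (u : R -> 'rV[R]_p) :
  (forall t : R, 0 < t -> is_derive t 1 u 0) -> u s @[s --> 0^'+] --> u 0 ->
  forall t : R, 0 <= t -> u t = u 0.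
Proof.
move=> u' u0 t t0; apply/rowP => k; apply/le_anti.
have u'k (s : R) : 0 < s -> is_derive s 1 (fun r => u r 0 k) 0.
  by move=> s0; have := is_derive_coord k (u' s s0); rewrite mxE.
have le0 (v : R -> R) : (forall s : R, 0 < s -> is_derive s 1 v 0) ->
    v s @[s --> 0^'+] --> v 0 -> v t <= v 0.
  move=> v' v0; have := @exponential_decay v (fun=> 0) 0 v' _ v0 t t0.
  by rewrite mul0r oppr0 expR0 mulr1; apply => s _; rewrite ?oppr0 mul0r.
apply/andP; split; first by apply: (le0 (fun s => u s 0 k)) => //; exact: cvg_coord.
rewrite -lerN2; apply: (le0 (fun s => - u s 0 k)); last by apply: cvgN; exact: cvg_coord.
by move=> s /u'k h; apply: (is_derive_eq (is_deriveN h)); exact: oppr0.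
Qed.

End Curves.

(** * Lyapunov function *)

Section LyapunovEstimates.
Variables (R : realType) (p : nat).
Implicit Types X Y P G m : 'rV[R]_p.

Lemma young_dotv (c : R) X Y : 0 < c ->
  - (2 * dotv X Y) <= c * sqn X + c^-1 * sqn Y.
Proof.
move=> c0; have := sqn_ge0 (c *: X + Y).
rewrite sqnD sqnZ dotvZl => h.
have := mulr_ge0 (ltW (etrans (invr_gt0 c) c0)) h.
have -> : c^-1 * (c ^+ 2 * sqn X + 2 * (c * dotv X Y) + sqn Y) =
    c * sqn X + 2 * dotv X Y + c^-1 * sqn Y by field; rewrite gt_eqF.
lra.
Qed.

Lemma young_dotv_le (c : R) X Y : 0 < c ->
  2 * dotv X Y <= c * sqn X + c^-1 * sqn Y.
Proof.
by move=> /(young_dotv (- X) Y); rewrite /sqn !dotvNl dotvNr mulrN !opprK.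
Qed.

Variables alpha beta mu l eps : R.

(* Contribution of one agent to the Lyapunov function: P and m are the
   disagreement and the average of the multiplier error, Y = Z + alpha P. *)
Definition lyap X Y P m : R :=
  2^-1 * sqn X + (2 * alpha)^-1 * sqn Y + alpha / 2 * sqn m
  + alpha / 2 * sqn P + eps * dotv X m.

Hypotheses (alpha0 : 0 < alpha) (eps0 : 0 < eps).
Hypotheses (eps1 : eps <= 2^-1) (eps_alpha : eps <= alpha / 2).

(** Coercivity in the original errors, since L = P + m and Z = Y - alpha P. The bounds on [eps] let
    the cross term consume at most |X|^2 / 4 and alpha |m|^2 / 4. *)
Lemma lyap_lower X Y P m :
  sqn X + sqn (P + m) + sqn (Y - alpha *: P)
    <= (4 + 8 * alpha + 12 / alpha) * lyap X Y P m.
Proof.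
have sX := sqn_ge0 X; have sY := sqn_ge0 Y.
have sP := sqn_ge0 P; have sm := sqn_ge0 m.
have lower : 4^-1 * sqn X + (2 * alpha)^-1 * sqn Y + alpha / 4 * sqn m
    + alpha / 2 * sqn P <= lyap X Y P m.
  have yXm := young_dotv X m ltr01.
  have := ler_wpM2l (ltW eps0) yXm.
  have := ler_wpM2r sX eps1; have := ler_wpM2r sm eps_alpha.
  rewrite /lyap invr1; lra.
have upper : sqn X + sqn (P + m) + sqn (Y - alpha *: P) <=
    sqn X + 2 * sqn P + 2 * sqn m + 2 * sqn Y + 2 * alpha ^+ 2 * sqn P.
  have := sqn_ge0 (P - m); have := sqn_ge0 (Y + alpha *: P).
  by rewrite /sqn !dotvE (dotvC m P) (dotvC P Y); lra.
apply: le_trans upper _.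
have C0 : 0 <= 4 + 8 * alpha + 12 / alpha.
  by rewrite !addr_ge0 ?mulr_ge0 ?invr_ge0 ?(ltW alpha0).
apply: le_trans (ler_wpM2l C0 lower).
rewrite -subr_ge0.
(* The constant is large enough for the difference to have only nonnegative coefficients. *)
have -> : (4 + 8 * alpha + 12 / alpha) * (4^-1 * sqn X + (2 * alpha)^-1 * sqn Y +
    alpha / 4 * sqn m + alpha / 2 * sqn P) -
    (sqn X + 2 * sqn P + 2 * sqn m + 2 * sqn Y + 2 * alpha ^+ 2 * sqn P) =
    (2 * alpha + 3 / alpha) * sqn X + (2 + 2 / alpha + 6 / alpha ^+ 2) * sqn Y
    + (alpha + 2 * alpha ^+ 2 + 1) * sqn m
    + (2 * alpha + 2 * alpha ^+ 2 + 4) * sqn P.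
  by field; rewrite gt_eqF.
by rewrite !addr_ge0 ?mulr_ge0 ?addr_ge0 ?mulr_ge0 ?invr_ge0 ?exprn_ge0 ?(ltW alpha0).
Qed.

Hypotheses (mu0 : 0 < mu) (alpha_mu : 1 <= alpha * mu).
Hypothesis eps_small : eps * (alpha * l ^+ 2 + alpha^-1 + 1) <= alpha * mu / 4.

(** The left side is what bounds V' once P.(Lap P) has been absorbed. By [eps_small], half of the
    damping in X pays for the [eps] term in X; |Y|^2 is controlled through |X|^2 and |X - Y|^2. *)
Lemma lyap_decrease X Y P m :
  - (alpha * mu / 2) * sqn X - sqn (X - Y) - alpha ^+ 2 / 2 * sqn P
  + eps * ((alpha * l ^+ 2 + alpha^-1 + 1) * sqn X - alpha / 2 * sqn m)
  <= - (eps / 8) * lyap X Y P m.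
Proof.
have sX := sqn_ge0 X; have sY := sqn_ge0 Y.
have sP := sqn_ge0 P; have sm := sqn_ge0 m.
have upper : lyap X Y P m <=
    sqn X + (2 * alpha)^-1 * sqn Y + alpha * sqn m + alpha / 2 * sqn P.
  have am := mulr_ge0 (ltW alpha0) sm.
  have yXm := young_dotv_le X m ltr01.
  have := ler_wpM2l (ltW eps0) yXm.
  have := ler_wpM2r sX eps1; have := ler_wpM2r sm eps_alpha.
  rewrite /lyap invr1; lra.
have e8 : 0 <= eps / 8 by rewrite divr_ge0 ?ler0n ?ltW.
have := ler_wpM2l e8 upper.
have hX := ler_wpM2r sX eps_small.
have hX1 := ler_wpM2r sX alpha_mu.
have XY : sqn Y <= 2 * sqn X + 2 * sqn (X - Y).
  have := sqn_ge0 (X + (X - Y)).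
  by rewrite /sqn !dotvE (dotvC Y X); lra.
have eX := ler_wpM2r sX eps1.
have eY : eps * alpha^-1 * sqn Y <= 2^-1 * sqn Y.
  by apply: ler_wpM2r => //; rewrite ler_pdivrMr// mulrC.
have eP : eps * alpha * sqn P <= alpha ^+ 2 / 2 * sqn P.
  by apply: ler_wpM2r => //; have := ler_wpM2r (ltW alpha0) eps_alpha; lra.
have em : 0 <= eps * alpha * sqn m by rewrite !mulr_ge0 ?(ltW eps0) ?(ltW alpha0).
have eP0 : 0 <= alpha ^+ 2 * sqn P by rewrite mulr_ge0 ?sqr_ge0.
have sXY := sqn_ge0 (X - Y).
rewrite invfM.
move: eps0 eps1 eps_alpha; lra.
Qed.

(** The term - alpha X.P costs half of the strong monotonicity and, as 1/mu <= alpha, a further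
    alpha^2 |P|^2 / 2. The final bracket pairs [dm - X], [Y] and [P], which sum to 0 over the
    agents, with vectors common to all agents. *)
Lemma lyap_rate X Y P G m LP dm : mu * sqn X <= dotv G X ->
  sqn G <= l ^+ 2 * sqn X ->
  let dX := - (alpha *: (G + (P + m))) - X + (Y - alpha *: P) in
  let dY := alpha *: (X - (Y - alpha *: P) - dm) in
  let dP := X - (Y - alpha *: P) - beta *: LP - dm in
  dotv X dX + alpha^-1 * dotv Y dY + alpha * dotv m dm + alpha * dotv P dP
    + eps * (dotv dX m + dotv X dm)
  <= - (alpha * mu / 2) * sqn X - sqn (X - Y) + 3 / 2 * alpha ^+ 2 * sqn P
     - alpha * beta * dotv P LP
     + eps * ((alpha * l ^+ 2 + alpha^-1 + 1) * sqn X - alpha / 2 * sqn m)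
     + (dotv (dm - X) (alpha *: m + eps *: dm) + dotv Y (eps *: m - dm)
        + dotv P (- (alpha *: dm) - (2 * alpha * eps) *: m)).
Proof.
move=> Gmono Glip /=.
have sX := sqn_ge0 X; have sP := sqn_ge0 P; have sm := sqn_ge0 m.
have := ler_wpM2l (ltW alpha0) Gmono.
have XP := young_dotv X P mu0.
have mua : mu^-1 * sqn P <= alpha * sqn P.
  by apply: ler_wpM2r => //; rewrite -[leLHS]mul1r ler_pdivrMr.
have aXP := ler_wpM2l (ltW alpha0) (le_trans XP (lerD (lexx _) mua)).
have ae0 : 0 <= alpha * eps by rewrite mulr_ge0 ?ltW.
(* The Young weights 2 and 2 / alpha each cost eps alpha |m|^2 / 4, which leaves half of the damping
   in m. *)
have Gm := ler_wpM2l ae0 (young_dotv G m (ltr0n R 2)).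
have Gl := ler_wpM2l ae0 Glip.
have Xm := ler_wpM2l (ltW eps0) (young_dotv X m (divr_gt0 (ltr0n R 2) alpha0)).
(* This trades X.dm for |X|^2 and (dm - X).dm; the latter goes into the final bracket. *)
have Xdm := ler_wpM2l (ltW eps0) (sqn_ge0 (X - dm)).
move: aXP Gm Gl Xm Xdm; rewrite invf_div /sqn !dotvE (dotvC Y X) (dotvC P X) (dotvC G X).
rewrite (dotvC P Y) (dotvC m dm) (dotvC dm X) mulKf ?gt_eqF//.
lra.
Qed.

End LyapunovEstimates.

Section LyapunovDerivative.
Variables (R : realType) (p : nat) (alpha eps : R).

Lemma is_derive_lyap (X Y P m : R -> 'rV[R]_p) (t : R) (dX dY dP dm : 'rV[R]_p) :
  alpha != 0 ->
  is_derive t 1 X dX -> is_derive t 1 Y dY ->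
  is_derive t 1 P dP -> is_derive t 1 m dm ->
  is_derive t 1 (fun s => lyap alpha eps (X s) (Y s) (P s) (m s))
    (dotv (X t) dX + alpha^-1 * dotv (Y t) dY + alpha * dotv (m t) dm
     + alpha * dotv (P t) dP + eps * (dotv dX (m t) + dotv (X t) dm)).
Proof.
move=> alpha0 hX hY hP hm.
have hZ c (h : R -> R) dh :
    is_derive t 1 h dh -> is_derive t 1 (fun s => c * h s) (c * dh).
  by move=> hh; exact: is_deriveZ.
apply: (is_derive_eq (is_deriveD (is_deriveD (is_deriveD (is_deriveD
  (hZ 2^-1 _ _ (is_derive_sqn hX)) (hZ (2 * alpha)^-1 _ _ (is_derive_sqn hY)))
  (hZ (alpha / 2) _ _ (is_derive_sqn hm))) (hZ (alpha / 2) _ _ (is_derive_sqn hP)))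
  (hZ eps _ _ (is_derive_dotv hX hm)))).
by field.
Qed.

Lemma cvg_lyap (T : Type) (F : set_system T) {FF : Filter F}
    (X Y P m : T -> 'rV[R]_p) (X0 Y0 P0 m0 : 'rV[R]_p) :
  X s @[s --> F] --> X0 -> Y s @[s --> F] --> Y0 ->
  P s @[s --> F] --> P0 -> m s @[s --> F] --> m0 ->
  lyap alpha eps (X s) (Y s) (P s) (m s) @[s --> F] --> lyap alpha eps X0 Y0 P0 m0.
Proof.
move=> hX hY hP hm.
have hZ c (h : T -> R) h0 : h s @[s --> F] --> h0 -> c * h s @[s --> F] --> c * h0.
  by move=> hh; apply: cvgM => //; exact: cvg_cst.
rewrite /lyap /sqn.
by repeat apply: cvgD; apply: hZ; exact: cvg_dotv.
Qed.

End LyapunovDerivative.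

(** * Exponential decay of the error system *)

Lemma error_system_decay (R : realType) (n p : nat) (a : 'I_n -> 'I_n -> R)
    (alpha beta mu l e : R) (X L Z G : R -> 'I_n -> 'rV[R]_p) :
  weight_balanced a -> (0 < n)%N ->
  0 < alpha -> 0 < mu -> 1 <= alpha * mu -> 0 <= beta -> 2 * alpha <= beta * e ->
  (forall P : 'I_n -> 'rV[R]_p, \sum_i P i = 0 ->
     e * \sum_i sqn (P i) <= \sum_i dotv (P i) (lap_apply a P i)) ->
  (forall t i, mu * sqn (X t i) <= dotv (G t i) (X t i)) ->
  (forall t i, sqn (G t i) <= l ^+ 2 * sqn (X t i)) ->
  (forall t : R, 0 < t -> \sum_i Z t i = 0) ->
  (forall i, X s i @[s --> 0^'+] --> X 0 i) ->
  (forall i, L s i @[s --> 0^'+] --> L 0 i) ->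
  (forall i, Z s i @[s --> 0^'+] --> Z 0 i) ->
  (forall t : R, 0 < t -> forall i, is_derive t 1 (fun s => X s i)
     (- (alpha *: (G t i + L t i)) - X t i + Z t i)) ->
  (forall t : R, 0 < t -> forall i, is_derive t 1 (fun s => L s i)
     (X t i - Z t i - beta *: lap_apply a (L t) i)) ->
  (forall t : R, 0 < t -> forall i, is_derive t 1 (fun s => Z s i)
     ((alpha * beta) *: lap_apply a (L t) i)) ->
  exists C c : R, [/\ 0 < C, 0 < c & forall t : R, 0 <= t ->
    \sum_i (sqn (X t i) + sqn (L t i) + sqn (Z t i)) <= C * expR (- (c * t))].
Proof.
move=> bal n0 alpha0 mu0 alpha_mu beta0 beta_e gap Gmono Glip sumZ cX cL cZ dX dL dZ.
have nR0 : n%:R != 0 :> R by rewrite pnatr_eq0 -lt0n.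
pose m s : 'rV[R]_p := n%:R^-1 *: \sum_i L s i.
pose P s i : 'rV[R]_p := L s i - m s.
pose Y s i : 'rV[R]_p := Z s i + alpha *: P s i.
have LE s i : L s i = P s i + m s by rewrite subrK.
have ZE s i : Z s i = Y s i - alpha *: P s i by rewrite addrK.
have sumP s : \sum_i P s i = 0.
  rewrite sumrB sumr_const card_ord -scaler_nat scalerA divff//.
  by rewrite scale1r subrr.
have lapP s i : lap_apply a (L s) i = lap_apply a (P s) i.
  by apply: eq_bigr => j _; rewrite /P opprB subrKA.
pose dm t : 'rV[R]_p := n%:R^-1 *: \sum_i X t i.
(* Averaging removes the Laplacian term, by balance, and [Z], whose sum is 0. *)
have m' (t : R) : 0 < t -> is_derive t 1 m (dm t).
  move=> t0; apply: (is_derive_eq (is_deriveZ _ (is_derive_sumf (dL t t0)))).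
  by rewrite !sumrB -scaler_sumr sum_lap_apply// sumZ// scaler0 !subr0.
have P' (t : R) i : 0 < t -> is_derive t 1 (fun s => P s i)
    (X t i - (Y t i - alpha *: P t i) - beta *: lap_apply a (P t) i - dm t).
  by move=> t0; rewrite -ZE -lapP; apply: is_deriveB; [exact: dL|exact: m'].
(* The factor [alpha] in [Y] makes the Laplacian terms of Z' and alpha P' cancel. *)
have Y' (t : R) i : 0 < t -> is_derive t 1 (fun s => Y s i)
    (alpha *: (X t i - (Y t i - alpha *: P t i) - dm t)).
  move=> t0; apply: (is_derive_eq (is_deriveD (dZ t t0 i) (is_deriveZ alpha (P' t i t0)))).
  by rewrite lapP; apply/rowP => k; rewrite !mxE; ring.
have X' (t : R) i : 0 < t -> is_derive t 1 (fun s => X s i)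
    (- (alpha *: (G t i + (P t i + m t))) - X t i + (Y t i - alpha *: P t i)).
  by move=> t0; rewrite -ZE -LE; exact: dX.
pose K := alpha * l ^+ 2 + alpha^-1 + 1.
have K0 : 0 < K.
  apply: ltr_wpDl ltr01; rewrite addr_ge0 ?invr_ge0 ?(ltW alpha0)//.
  by rewrite mulr_ge0 ?sqr_ge0 ?(ltW alpha0).
pose eps := Num.min (2^-1) (Num.min (alpha / 2) (alpha * mu / 4 / K)).
have eps0 : 0 < eps by rewrite !lt_min invr_gt0 !divr_gt0 ?mulr_gt0 ?ltr0n.
have eps1 : eps <= 2^-1 by rewrite ge_min lexx.
have eps_alpha : eps <= alpha / 2 by rewrite !ge_min lexx orbT.
have eps_small : eps * K <= alpha * mu / 4.
  by rewrite -ler_pdivlMr// !ge_min lexx !orbT.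
pose V s := \sum_i lyap alpha eps (X s i) (Y s i) (P s i) (m s).
have V' (t : R) : 0 < t -> is_derive t 1 V _ := fun t0 =>
  is_derive_sumf (fun i => is_derive_lyap eps (lt0r_neq0 alpha0)
    (X' t i t0) (Y' t i t0) (P' t i t0) (m' t t0)).
have cm : m s @[s --> 0^'+] --> m 0.
  by apply: cvgZr; apply: cvg_sumv => i _; exact: cL.
have cP i : P s i @[s --> 0^'+] --> P 0 i by apply: cvgB.
have cY i : Y s i @[s --> 0^'+] --> Y 0 i by apply: cvgD => //; exact: cvgZr.
have cV : V s @[s --> 0^'+] --> V 0.
  by apply: (@cvg_sumv R R) => i _; exact: cvg_lyap.
have Vdecay := exponential_decay (c := eps / 8) V' _ cV.
have {}Vdecay (t : R) : 0 <= t -> V t <= V 0 * expR (- (eps / 8 * t)).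
  apply: Vdecay => {}t t0.
  apply: le_trans (ler_sum _ (fun i _ => lyap_rate beta alpha0 eps0 mu0 alpha_mu
    (Y t i) (P t i) (m t) (lap_apply a (P t) i) (dm t) (Gmono t i) (Glip t i))) _.
  (* These zero sums eliminate the bracket of [lyap_rate]. *)
  have sumY : \sum_i Y t i = 0.
    by rewrite big_split /= -scaler_sumr sumP sumZ// scaler0 addr0.
  have sumX : \sum_i (dm t - X t i) = 0.
    rewrite sumrB sumr_const card_ord -scaler_nat scalerA divff//.
    by rewrite scale1r subrr.
  rewrite big_split /= [X in _ + X]big_split [X in _ + (X + _)]big_split /=.
  rewrite -!dotv_suml sumX sumY sumP !dotv0l !addr0.
  have := ler_sum (index_enum 'I_n) (fun i (_ : xpredT i) =>
    lyap_decrease alpha0 eps0 eps1 eps_alpha alpha_mu eps_small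
      (X t i) (Y t i) (P t i) (m t)).
  rewrite -mulr_sumr -/(V t); apply: le_trans.
  (* The excess over [lyap_decrease] is 2 alpha^2 |P|^2 - alpha beta P.(Lap P), summed over the
     agents; it is nonpositive by [gap] and [beta_e]. *)
  rewrite -subr_le0 -sumrB.
  rewrite (eq_bigr (fun i => 2 * alpha ^+ 2 * sqn (P t i)
    - alpha * beta * dotv (P t i) (lap_apply a (P t) i))); last first.
    by move=> i _; field; rewrite gt_eqF.
  rewrite sumrB -!mulr_sumr.
  have SP : 0 <= \sum_i sqn (P t i) by apply: sumr_ge0 => i _; exact: sqn_ge0.
  have := ler_wpM2l (mulr_ge0 (ltW alpha0) beta0) (gap _ (sumP t)).
  have := ler_wpM2l (ltW alpha0) (ler_wpM2r SP beta_e).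
  lra.
pose C0 := 4 + 8 * alpha + 12 / alpha.
have C00 : 0 <= C0.
  by rewrite !addr_ge0 ?mulr_ge0 ?invr_ge0 ?(ltW alpha0).
have distV (t : R) : \sum_i (sqn (X t i) + sqn (L t i) + sqn (Z t i)) <= C0 * V t.
  rewrite mulr_sumr; apply: ler_sum => i _; rewrite LE ZE; exact: lyap_lower.
have V0 : 0 <= C0 * V 0.
  by apply: le_trans (distV 0); apply: sumr_ge0 => i _; rewrite !addr_ge0 ?sqn_ge0.
(* Adding 1 keeps the constant positive when the initial error is 0. *)
exists (C0 * V 0 + 1), (eps / 8); split; [lra|by rewrite divr_gt0|].
move=> t t0; apply: le_trans (distV t) _.
have := ler_wpM2l C00 (Vdecay t t0); have := expR_gt0 (- (eps / 8 * t)); lra.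
Qed.

(** * Convergence of IDEA to the optimal solution *)

Unset Implicit Arguments.

Theorem theorem4 (R : realType) (n p : nat)
  (f : 'I_n -> 'rV[R]_p -> R) (g : 'I_n -> 'rV[R]_p -> 'rV[R]_p)
  (b : 'rV[R]_p) (bi : 'I_n -> 'rV[R]_p)
  (a : 'I_n -> 'I_n -> R)
  (mui li : 'I_n -> R) (mu l phi alpha beta eta2 : R)
  (x lam z : R -> 'I_n -> 'rV[R]_p) :
  (2 <= n)%N ->
  (* Assumption 1 and problem data *)
  (forall i, gradient_of (f i) (g i)) ->
  (exists y : 'I_n -> 'rV[R]_p, feasibleP b y) ->                      (* Slater (X = R^{np}) *)
  (exists y, optimalP f b y) ->                     (* (P) has an optimal solution *)
  (forall i, strongly_convex (mui i) (f i)) ->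
  (forall i, smooth (li i) (g i)) ->
  (* graph *)
  nonneg_weights a -> weight_balanced a -> strongly_connected a ->
  second_smallest_eig (sym_part (laplacian a)) eta2 ->
  (* parameters *)
  ((forall i, mu <= mui i) /\ exists i, mu = mui i) ->
  ((forall i, li i <= l) /\ exists i, l = li i) ->
  0 < phi ->
  2^-1 <= alpha ->
  ((phi ^+ 2 + 3 * phi + 3) + l ^+ 2 + 3 / 2 - mu) / ((phi + 1) * mu) <= alpha ->
  (2 * (phi + 1) ^+ 2 * alpha ^+ 2 + 1) / (2 * phi * alpha * eta2) <= beta ->
  (* splitting of b *)
  \sum_(i < n) bi i = b ->
  (* initial condition *)
  \sum_(i < n) z 0 i = 0 ->
  (* (x, lam, z) is a trajectory of IDEA on [0, +oo) *)
  (forall i, x s i @[s --> 0^'+] --> x 0 i) ->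
  (forall i, lam s i @[s --> 0^'+] --> lam 0 i) ->
  (forall i, z s i @[s --> 0^'+] --> z 0 i) ->
  (forall t : R, 0 < t -> forall i,
     is_derive t 1 (fun s => x s i)
       (- (alpha *: (g i (x t i) + lam t i)) - (x t i - bi i - z t i))) ->
  (forall t : R, 0 < t -> forall i,
     is_derive t 1 (fun s => lam s i)
       (x t i - bi i - z t i - beta *: lap_apply a (lam t) i)) ->
  (forall t : R, 0 < t -> forall i,
     is_derive t 1 (fun s => z s i) ((alpha * beta) *: lap_apply a (lam t) i)) ->
  exists (xs ls zs : 'I_n -> 'rV[R]_p) (C c : R),
    0 < C /\ 0 < c /\
    (forall t : R, 0 <= t ->
       state_dist (x t) xs (lam t) ls (z t) zs <= C * expR (- (c * t))) /\
    optimalP f b xs /\ (forall y, optimalP f b y -> y = xs).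
Proof.
move=> n2 fg _ [xs xopt] fconv gsmooth a0 bal conn eigL [mu_le [i0 mu_i0]] [l_ge _].
move=> phi0 alpha_half alpha_ge beta_ge bib sumz0 cx cl cz dx dl dz.
have [eta0 gap] := lap_apply_gap bal a0 n2 conn eigL.
have mu0 : 0 < mu by rewrite mu_i0; case: (fconv i0).
have alpha0 : 0 < alpha by apply: lt_le_trans alpha_half; rewrite invr_gt0.
(* If alpha mu < 1, then mu < 2 since alpha >= 1/2, so the numerator in [alpha_ge] exceeds phi + 1,
   hence also alpha (phi + 1) mu, a contradiction. *)
have alpha_mu : 1 <= alpha * mu.
  move: alpha_ge; rewrite ler_pdivrMr; last by rewrite mulr_gt0// addr_gt0.
  have := ler_wpM2r (ltW mu0) alpha_half.
  have := sqr_ge0 l; have := sqr_ge0 phi.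
  move=> h1 h2 h3 h4; rewrite leNgt; apply/negP => h5.
  have := ler_wpM2l (ltW phi0) (ltW h5); lra.
(* After multiplication by 2 phi alpha, this follows from 4 phi alpha^2 <= 2 (phi + 1)^2 alpha^2 +
   1. *)
have beta_eta : 2 * alpha <= beta * eta2.
  move: beta_ge; rewrite ler_pdivrMr ?mulr_gt0// => h.
  have h1 : 2 * phi * alpha * (2 * alpha) <= 2 * phi * alpha * (beta * eta2).
    have := sqr_ge0 (phi * alpha - alpha); have := sqr_ge0 alpha;
    have := sqr_ge0 (phi * alpha); lra.
  by move: h1; rewrite ler_pM2l ?mulr_gt0.
have beta0 : 0 <= beta.
  rewrite -(pmulr_lge0 _ eta0); apply: le_trans beta_eta.
  by rewrite mulr_ge0 ?ltW.
pose lstar : 'rV[R]_p := - g i0 (xs i0).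
have gE i : g i (xs i) = - lstar.
  by rewrite /lstar opprK (optimal_gradients_eq fg _ i0 xopt).
pose X t i : 'rV[R]_p := x t i - xs i.
pose L t i : 'rV[R]_p := lam t i - lstar.
pose Z t i : 'rV[R]_p := z t i - (xs i - bi i).
pose G t i : 'rV[R]_p := g i (x t i) - g i (xs i).
have sum_zs : \sum_i (xs i - bi i) = 0.
  by rewrite sumrB bib; case: xopt => -> _; rewrite subrr.
(* The sum of the [z t i] is conserved, because the Laplacian terms sum to 0. *)
have sum_z (t : R) : 0 < t -> \sum_i z t i = 0.
  move=> t0; apply: etrans sumz0.
  apply: (constant_of_derive0 (u := fun s => \sum_i z s i)); last exact: ltW.
    move=> {t0}t t0; apply: (is_derive_eq (is_derive_sumf (dz t t0))).
    by rewrite -scaler_sumr sum_lap_apply// scaler0.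
  by apply: cvg_sumv => i _; exact: cz.
have lapL t i : lap_apply a (L t) i = lap_apply a (lam t) i.
  by apply: eq_bigr => j _; rewrite /L opprB subrKA.
have shift_derive (u : R -> 'rV[R]_p) (c : 'rV[R]_p) (t : R) (du dv : 'rV[R]_p) :
    is_derive t 1 u du -> du = dv -> is_derive t 1 (fun s => u s - c) dv.
  move=> hu <-; apply: (is_derive_eq (is_deriveB hu (is_derive_cst c t 1))).
  by rewrite subr0.
have [C [c [C0 c0 decay]]] : exists C c : R, [/\ 0 < C, 0 < c &
    forall t : R, 0 <= t ->
      \sum_i (sqn (X t i) + sqn (L t i) + sqn (Z t i)) <= C * expR (- (c * t))].
  apply: (error_system_decay (X := X) (L := L) (Z := Z) (G := G) (l := l)
    bal (ltnW n2) alpha0 mu0 alpha_mu beta0 beta_eta (@gap p)).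
  - move=> t i; apply: le_trans (gradient_strongly_monotone _ _ (fg i) (fconv i)).
    by rewrite ler_wpM2r ?sqn_ge0.
  - by move=> t i; exact: smooth_sqn (gsmooth i) (l_ge i).
  - by move=> t t0; rewrite sumrB sum_zs sum_z// subrr.
  - by move=> i; apply: cvgB => //; exact: cvg_cst.
  - by move=> i; apply: cvgB => //; exact: cvg_cst.
  - by move=> i; apply: cvgB => //; exact: cvg_cst.
  - move=> t t0 i; apply: shift_derive (dx t t0 i) _.
    by rewrite /G gE; apply/rowP => k; rewrite !mxE; ring.
  - move=> t t0 i; apply: shift_derive (dl t t0 i) _.
    by rewrite lapL; apply/rowP => k; rewrite !mxE; ring.
  - move=> t t0 i; apply: shift_derive (dz t t0 i) _.
    by rewrite lapL.
(* [decay] concerns the squared distance, so the square root halves the rate. *)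
exists xs, (fun=> lstar), (fun i => xs i - bi i), (Num.sqrt C), (c / 2).
split; first by rewrite sqrtr_gt0.
split; first by rewrite divr_gt0.
split; last by split=> // y; exact: optimal_unique fconv xopt.
move=> t t0; apply: le_trans (ler_wsqrtr (decay t t0)) _.
rewrite sqrtrM ?(ltW C0)// ler_wpM2l ?sqrtr_ge0//.
have -> : - (c * t) = - (c / 2 * t) + - (c / 2 * t) by field.
by rewrite expRD -expr2 sqrtr_sqr ger0_norm ?expR_ge0.
Qed.
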